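(* Let $\mathcal{C}_1=(\mathcal{A}_1,\mathcal{G}_1)$ and $\mathcal{C}_2=(\mathcal{A}_2,\mathcal{G}_2)$ be contracts with $\mathcal{A}_j: A_j(\tfrac{d}{dt})u=0$ and $\mathcal{G}_j: G_j(\tfrac{d}{dt})y=0$. Then the conjunction of $\mathcal{C}_1$ and $\mathcal{C}_2$ is $(\mathcal{A}_1\vee\mathcal{A}_2,\ \mathcal{G}_1\wedge\mathcal{G}_2)$; that is, the contract $(\mathcal{A}_1\vee\mathcal{A}_2,\mathcal{G}_1\wedge\mathcal{G}_2)$ refines both $\mathcal{C}_1$ and $\mathcal{C}_2$, and every contract that refines both $\mathcal{C}_1$ and $\mathcal{C}_2$ refines $(\mathcal{A}_1\vee\mathcal{A}_2,\mathcal{G}_1\wedge\mathcal{G}_2)$.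
   Context: $C^\infty(\mathbb{R},\mathbb{R}^n)$ is the space of smooth functions $\mathbb{R}\to\mathbb{R}^n$; for a real polynomial matrix $R(s)=\sum_i R_is^i$, $R(\tfrac{d}{dt})w=\sum_i R_i w^{(i)}$. A system $\Sigma: P(\tfrac{d}{dt})y=Q(\tfrac{d}{dt})u$ (real polynomial matrices $P,Q$, $u\in C^\infty(\mathbb{R},\mathbb{R}^m)$, $y\in C^\infty(\mathbb{R},\mathbb{R}^p)$) is in input-output form if $P(s)$ is square and invertible and $P(s)^{-1}Q(s)$ is a proper rational matrix; its external behaviour is $\mathfrak{B}(\Sigma)=\{(u,y): P(\tfrac{d}{dt})y=Q(\tfrac{d}{dt})u\}$. An environment is $\mathcal{E}: 0=E(\tfrac{d}{dt})u$ with input behaviour $\mathfrak{B}_i(\mathcal{E})=\{u: E(\tfrac{d}{dt})u=0\}$. Assumptions $\mathcal{A}: 0=A(\tfrac{d}{dt})u$ have input behaviour $\mathfrak{B}_i(\mathcal{A})=\{u:A(\tfrac{d}{dt})u=0\}$; guarantees $\mathcal{G}: G(\tfrac{d}{dt})y=0$ have output behaviour $\mathfrak{B}_o(\mathcal{G})=\{y:G(\tfrac{d}{dt})y=0\}$ (all $A,E,G$ real polynomial matrices; assumptions may also be given via latent variables, in which case $\mathfrak{B}_i$ is the set of $u$ for which latent variables exist satisfying the equations). The interconnection of an environment $\mathcal{E}$ with $\Sigma$ has output behaviour $\mathfrak{B}_o(\mathcal{E}\wedge\Sigma)=\{y:\exists u\in\mathfrak{B}_i(\mathcal{E}),\ (u,y)\in\mathfrak{B}(\Sigma)\}$.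 A contract is a pair $\mathcal{C}=(\mathcal{A},\mathcal{G})$. An environment $\mathcal{E}$ is compatible with $\mathcal{C}$ if $\mathfrak{B}_i(\mathcal{E})\subset\mathfrak{B}_i(\mathcal{A})$; a system $\Sigma$ in input-output form implements $\mathcal{C}$ if $\mathfrak{B}_o(\mathcal{E}\wedge\Sigma)\subset\mathfrak{B}_o(\mathcal{G})$ for every environment $\mathcal{E}$ compatible with $\mathcal{C}$. Contract $\mathcal{C}_1$ refines $\mathcal{C}_2$ if every environment compatible with $\mathcal{C}_2$ is compatible with $\mathcal{C}_1$ and every implementation of $\mathcal{C}_1$ is an implementation of $\mathcal{C}_2$. The conjunction $\mathcal{C}_1\wedge\mathcal{C}_2$ is the largest (with respect to refinement) contract that refines both $\mathcal{C}_1$ and $\mathcal{C}_2$. The join $\mathcal{A}_1\vee\mathcal{A}_2$ is the assumptions with latent variables $l_1,l_2\in C^\infty(\mathbb{R},\mathbb{R}^m)$ given by $l_1+l_2=u$, $A_1(\tfrac{d}{dt})l_1=0$, $A_2(\tfrac{d}{dt})l_2=0$, i.e. $\mathfrak{B}_i(\mathcal{A}_1\vee\mathcal{A}_2)=\{u:\exists l_1,l_2 \text{ smooth with } l_1+l_2=u,\ A_1(\tfrac{d}{dt})l_1=0,\ A_2(\tfrac{d}{dt})l_2=0\}$. The meet $\mathcal{G}_1\wedge\mathcal{G}_2$ is the guarantees $\begin{bmatrix}G_1(\tfrac{d}{dt})\\ G_2(\tfrac{d}{dt})\end{bmatrix}y=0$. *)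

(* Defs.v *)
From HB Require Import structures.
From mathcomp Require Import all_boot all_order all_algebra.
From mathcomp Require Import all_classical all_reals all_analysis.
Set Implicit Arguments. Unset Strict Implicit. Unset Printing Implicit Defensive.
Import Order.TTheory GRing.Theory Num.Theory.
Import numFieldNormedType.Exports.
Local Open Scope classical_set_scope.
Local Open Scope ring_scope.

Section Behaviours.
Variable R : realType.

Definition traj (n : nat) := R -> 'cV[R]_n.

Definition smooth n (w : traj n) : Prop :=
  forall (k : nat) (t : R), derivable (derive1n k w) t 1.

Definition pmx_deg r n (P : 'M[{poly R}]_(r, n)) : nat :=
  (\max_(i < r) \max_(j < n) size (P i j))%N.

Definition coefmx r n (P : 'M[{poly R}]_(r, n)) (k : nat) : 'M[R]_(r, n) :=
  map_mx (fun q : {poly R} => q`_k) P.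

Definition polyop r n (P : 'M[{poly R}]_(r, n)) (w : traj n) : traj r :=
  fun t => \sum_(k < pmx_deg P) coefmx P k *m derive1n k w t.

Definition kerbeh r n (P : 'M[{poly R}]_(r, n)) : set (traj n) :=
  [set w | smooth w /\ polyop P w = (fun=> 0)].

Definition latbeh r m l (AU : 'M[{poly R}]_(r, m)) (AL : 'M[{poly R}]_(r, l))
  : set (traj m) :=
  [set u | smooth u /\ exists lv : traj l, smooth lv /\
      (fun t => polyop AU u t + polyop AL lv t) = (fun=> 0)].

(* system P(d/dt) y = Q(d/dt) u in input-output form: P square, det P <> 0,
   P^{-1} Q = adj(P) Q / det(P) proper *)
Definition io_form p m (P : 'M[{poly R}]_p) (Q : 'M[{poly R}]_(p, m)) : Prop :=
  \det P != 0 /\ forall i j, (size ((\adj P *m Q) i j) <= size (\det P))%N.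

Definition ext_beh p m (P : 'M[{poly R}]_p) (Q : 'M[{poly R}]_(p, m))
  : set (traj m * traj p) :=
  [set uy | smooth uy.1 /\ smooth uy.2 /\ polyop P uy.2 = polyop Q uy.1].

Definition out_beh k p m (E : 'M[{poly R}]_(k, m)) (P : 'M[{poly R}]_p)
  (Q : 'M[{poly R}]_(p, m)) : set (traj p) :=
  [set y | exists u, kerbeh E u /\ ext_beh P Q (u, y)].

(* A contract is described semantically by its input behaviour of the
   assumptions and its output behaviour of the guarantees. *)
Definition compatible k m (E : 'M[{poly R}]_(k, m)) (Ai : set (traj m)) : Prop :=
  kerbeh E `<=` Ai.

Definition implements p m (P : 'M[{poly R}]_p) (Q : 'M[{poly R}]_(p, m))
  (Ai : set (traj m)) (Go : set (traj p)) : Prop :=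
  forall k (E : 'M[{poly R}]_(k, m)), compatible E Ai -> out_beh E P Q `<=` Go.

Definition refines m p (C1 C2 : set (traj m) * set (traj p)) : Prop :=
  (forall k (E : 'M[{poly R}]_(k, m)), compatible E C2.1 -> compatible E C1.1) /\
  (forall (P : 'M[{poly R}]_p) (Q : 'M[{poly R}]_(p, m)), io_form P Q ->
      implements P Q C1.1 C1.2 -> implements P Q C2.1 C2.2).

Definition join_beh m r1 r2 (A1 : 'M[{poly R}]_(r1, m)) (A2 : 'M[{poly R}]_(r2, m))
  : set (traj m) :=
  [set u | exists l1 l2 : traj m, smooth l1 /\ smooth l2 /\
      u = (fun t => l1 t + l2 t) /\
      polyop A1 l1 = (fun=> 0) /\ polyop A2 l2 = (fun=> 0)].

(* general contracts: assumptions given with latent variables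
   AU(d/dt) u + AL(d/dt) l = 0, guarantees G(d/dt) y = 0 *)
Record bcontract (m p : nat) := Contract {
  c_arows : nat; c_alat : nat;
  c_AU : 'M[{poly R}]_(c_arows, m);
  c_AL : 'M[{poly R}]_(c_arows, c_alat);
  c_grows : nat;
  c_G : 'M[{poly R}]_(c_grows, p) }.

Definition contract_sem m p (C : bcontract m p) : set (traj m) * set (traj p) :=
  (latbeh (c_AU C) (c_AL C), kerbeh (c_G C)).

End Behaviours.

(* Main.v *)
Require Import Defs.
From HB Require Import structures.
From mathcomp Require Import all_boot all_order all_algebra.
From mathcomp Require Import all_classical all_reals all_analysis.
From mathcomp Require complex.
From mathcomp Require Import ring.
Import Order.TTheory GRing.Theory Num.Theory.
Import numFieldNormedType.Exports.
Set Implicit Arguments. Unset Strict Implicit. Unset Printing Implicit Defensive.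
Local Open Scope classical_set_scope.
Local Open Scope ring_scope.

(** If [C] refines [C1], then every square nonsingular [P] with
    [ker P <= ker G] (for [G] the guarantees of [C]) satisfies
    [ker P <= ker G1]: the system [P y = 0 u] implements [C], hence [C1], and
    the input [u = 0] is allowed by [A1]. This forces [ker G <= ker G1].
    Make [G] square by row operations and let [D] be the idempotent that marks
    its nonzero rows, so that [P1 = G + (1 - D)] is nonsingular. With
    [N = adj P1 (1 - D)], the autonomous behaviours
    [ker ((D + ('X - l) (1 - D)) P1)] contain [N (exp (l t) v)] for every rate
    [l] and vector [v], so [G1 N] vanishes at every [l] and [G1 N = 0]. Given
    [y] in [ker G], solve [det P1 z = y]; then [y - N z] lies in [ker P1], hence
    in [ker G1], and [G1 N z = 0]. So [y] is in [ker G1].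
    The remaining inclusions are formal: the assumptions of [C] are closed under
    addition and contain [ker A1] and [ker A2], hence their join. *)

(** * Row operations on polynomial matrices over a field *)

Section PolyMatrix.
Variable F : fieldType.

(** Here [a *m f] is a gcd of the entries of [f], written by Bezout coefficients [a], and [b] holds
    the quotients of the entries by it. *)
Lemma colvec_gcd k (f : 'cV[{poly F}]_k) :
  exists (a : 'rV[{poly F}]_k) (b : 'cV[{poly F}]_k), f = b *m (a *m f).
Proof.
elim: k f => [|k IH] f; first by exists 0, 0; apply/matrixP => -[].
move: f; rewrite -[k.+1]/(1 + k)%N => f.
rewrite -(vsubmxK f); set f0 := usubmx f; set f1 := dsubmx f.
have [a1 [b1 f1E]] := IH f1.
set g := (a1 *m f1) 0 0.
have [[u v]] := Bezoutp (f0 0 0) g; set h := u * _ + v * _ => hgcd.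
have /dvdpP[c0 c0E] : h %| f0 0 0 by rewrite (eqp_dvdl _ hgcd) dvdp_gcdl.
have /dvdpP[c1 c1E] : h %| g by rewrite (eqp_dvdl _ hgcd) dvdp_gcdr.
exists (row_mx u%:M (v *: a1)), (col_mx c0%:M (c1 *: b1)).
have -> : row_mx u%:M (v *: a1) *m col_mx f0 f1 = h%:M.
  rewrite mul_row_col mul_scalar_mx -scalemxAl.
  apply/matrixP => i j; rewrite !ord1 !mxE eqxx mulr1n /h /g.
  by rewrite !mxE.
rewrite mul_col_mx mul_scalar_mx scale_scalar_mx -c0E; congr col_mx.
  by apply/matrixP => i j; rewrite !ord1 !mxE eqxx mulr1n.
rewrite -scalemxAl mul_mx_scalar scalerA -c1E -mul_mx_scalar {1}f1E.
congr (_ *m _); apply/matrixP => i j; rewrite !ord1 [RHS]mxE eqxx mulr1n.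
by [].
Qed.

(* Weak Hermite form: [X *m A] is square with the same row module as [A], and
   [D] is the diagonal idempotent marking its nonzero rows. *)
Lemma row_module_square k p (A : 'M[{poly F}]_(k, p)) :
  exists (X : 'M[{poly F}]_(p, k)) (Y : 'M[{poly F}]_(k, p)) (D : 'M[{poly F}]_p),
    [/\ A = Y *m (X *m A), D *m D = D, D *m (X *m A) = X *m A &
        \det (X *m A + (1%:M - D)) != 0].
Proof.
elim: p k A => [|p IH] k A.
  exists 0, 0, 0; split; rewrite ?det_mx00 ?oner_neq0 //; apply/matrixP => i [] //;
    case: i.
move: A; rewrite -[p.+1]/(1 + p)%N => A.
rewrite -(hsubmxK A); set f := lsubmx A; set A' := rsubmx A.
pose dl : {poly F} := (f != 0)%:R.
(* When the first column vanishes, [a] is chosen zero, so that the new top row is zero exactly where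
   [dl] says so. *)
have [a [b [fE aE]]] : exists (a : 'rV[{poly F}]_k) (b : 'cV[{poly F}]_k),
    f = b *m (a *m f) /\ dl%:M *m a = a.
  rewrite /dl; have [->|f0] := eqVneq f 0.
    by exists 0, 0; rewrite !mulmx0.
  by have [a [b fE]] := colvec_gcd f; exists a, b; rewrite mul1mx.
have dldl : dl * dl = dl by rewrite /dl; case: (f != 0); rewrite ?mulr1 ?mulr0.
have [X [Y [D [AE DD DG dG]]]] := IH k (A' - b *m (a *m A')).
set A2 := A' - _ in AE DG dG.
(* The top row extracts the gcd of the first column. The factor [1 - b a] subtracts multiples of
   that row, which clears the first column since [f = b a f], and leaves [A2] for the recursion. *)
pose XX := col_mx a (X *m (1%:M - b *m a)).
have XXE : XX *m row_mx f A' = block_mx (a *m f) (a *m A') 0 (X *m A2).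
  rewrite mul_col_row -!mulmxA !mulmxBl !mul1mx -!mulmxA -fE subrr mulmx0.
  by [].
exists XX, (row_mx b Y), (block_mx dl%:M 0 0 D); split.
- rewrite XXE mul_row_block mulmx0 addr0 -fE -AE; congr row_mx.
  by rewrite /A2 addrC subrK.
- by rewrite mulmx_block !mulmx0 !mul0mx !addr0 !add0r DD -scalar_mxM dldl.
- rewrite XXE mulmx_block !mulmx0 !mul0mx !addr0 !add0r DG.
  by rewrite !mulmxA aE.
rewrite XXE scalar_mx_block opp_block_mx !add_block_mx !subr0 !addr0.
rewrite det_ublock mulf_neq0 //.
rewrite -raddfB /= det_mx11 [in X in X != 0]mxE [X in _ + X]mxE eqxx mulr1n.
rewrite /dl; have [->|f0] := eqVneq f 0.
  by rewrite mulmx0 mxE add0r subr0 oner_neq0.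
(* A zero gcd would give [f = b (a f) = 0]. *)
rewrite subrr addr0; apply: contraNneq f0 => af0.
rewrite fE (_ : a *m f = 0) ?mulmx0 //.
by apply/matrixP => i j; rewrite !ord1 af0 mxE.
Qed.

End PolyMatrix.

(** * Real factors of degree at most two *)

Section RealPoly.
Import complex.

(** A complex root [a + i b] of [q] supplies the factor: its real minimal polynomial. *)
Lemma real_poly_factor (R : rcfType) (q : {poly R}) : (1 < size q)%N ->
  exists a b : R,
    if b == 0 then 'X - a%:P %| q else ('X - a%:P) ^+ 2 + (b ^+ 2)%:P %| q.
Proof.
move=> q1.
have /closed_rootP[[a b]] : size (map_poly (real_complex R) q) != 1%N.
  by rewrite size_map_poly neq_ltn q1 orbT.
move=> rq.
exists a, b; have [b0|b0] := eqVneq b 0.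
  move: rq; rewrite b0 -[complex.Complex a 0]/(real_complex R a).
  by rewrite fmorph_root dvdp_XsubCl.
set d := _ + _.
have d3 : size d = 3%N.
  by rewrite /d size_polyDl ?size_exp_XsubC // (leq_ltn_trans (size_polyC_leq1 _)).
have dr : root (map_poly (real_complex R) d) (complex.Complex a b).
  rewrite /root /d rmorphD rmorphXn /= map_polyXsubC map_polyC /= !hornerE.
  by rewrite /= !expr2; simpc; rewrite addNr.
(* The remainder is real, of degree at most one, and vanishes at [a + i b]. The imaginary part of
   its value is [r_1 b], so [r_1 = 0], and then [r_0 = 0]. *)
apply/modp_eq0P; set r := q %% d.
have rr : root (map_poly (real_complex R) r) (complex.Complex a b).
  have -> : r = q - q %/ d * d by rewrite {1}(divp_eq q d) addrC addKr.
  move/rootP: dr => dr; move/rootP: rq => rq.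
  apply/rootP; rewrite rmorphB rmorphM /= hornerD hornerN hornerM dr rq.
  by rewrite mulr0 subr0.
have r2 : (size r <= 2)%N by rewrite -ltnS -d3 ltn_modp -size_poly_eq0 d3.
have rE : r = (r`_1)%:P * 'X + (r`_0)%:P.
  apply/polyP => -[|[|i]]; rewrite !coefE /= ?mulr0 ?add0r ?mulr1 ?addr0 //.
  by rewrite nth_default // (leq_trans r2).
move: rr; rewrite rE /root rmorphD rmorphM /= map_polyX !map_polyC /= !hornerE /=.
simpc => /eqP[h0 /eqP]; rewrite mulf_eq0 (negPf b0) orbF => /eqP r10.
by move: h0; rewrite r10 mul0r add0r => ->; rewrite mul0r addr0.
Qed.

End RealPoly.

(** * Antiderivatives, smooth scalar functions and a first-order complex equation *)

Section Analysis.
Variable R : realType.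
Local Notation mu := (@lebesgue_measure R).

(* A record, so that [done] does not unfold it when matching hypotheses. *)
Record smoothR (f : R -> R) : Prop := SmoothR {
  smoothR_derivable :> forall (k : nat) (t : R), derivable (derive1n k f) t 1 }.

Lemma antiderivative_half (f : R -> R) : continuous f ->
  (forall x, x <= 0 -> f x = 0) ->
  exists F : R -> R, forall x : R, is_derive x (1:R) F (f x).
Proof.
move=> cf f0.
(* Integrating from -oo avoids a case distinction on the sign of [x]. *)
exists (fun x => \int[mu]_(t in [set` `]-oo, x]]) f t)%R => x.
(* The fundamental theorem at [x] is applied on a range reaching strictly past [x], hence [x + 1].
   The integrand lives on the compact segment from [0] to [x + 1]. *)
have int : mu.-integrable [set` `]-oo, x + 1]] (EFin \o f).
  have [x0|x0] := leP (x + 1) 0.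
    apply: (@eq_integrable _ _ _ mu _ _ (cst 0%E)) => //; last exact: integrable0.
    move=> t; rewrite inE /= in_itv /= => tx; rewrite f0 //.
    exact: le_trans tx x0.
  apply/integrable_mkcond => //.
  have -> : (EFin \o f) \_ `]-oo, x + 1] = (EFin \o f) \_ `[0, x + 1].
    apply/funext => t; rewrite !patchE /= !mem_setE !in_itv /=.
    have [t0|t0] := leP 0 t; first by [].
    by case: ifP => //= _; rewrite f0 // ltW.
  have : mu.-integrable `[0, x + 1] (EFin \o f).
    apply: continuous_compact_integrable; first exact: segment_compact.
    exact: continuous_subspaceT.
  by move/integrable_mkcond; apply.
have xx : x < x + 1 by rewrite ltrDl.
have [dF F'] := @continuous_FTC1 R f -oo%O x (x + 1) xx int (ltNyr x) (cf x).
by apply: DeriveDef; [exact: dF|rewrite -derive1E; exact: F'].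
Qed.

(** Write [f x = fp x + fn (- x) + f 0], where [fp] and [fn] vanish on the negative half line; the
    second piece is integrated after a reflection, hence the minus sign before [F2]. *)
Lemma antiderivative (f : R -> R) : continuous f ->
  exists F : R -> R, forall x : R, is_derive x (1:R) F (f x).
Proof.
move=> cf.
have cmax : continuous (fun x : R => Num.max x 0 : R).
  move=> x; apply: (@continuous_max R R id (cst 0)); first exact: cvg_id.
  exact: cvg_cst.
pose fp x := f (Num.max x 0) - f 0; pose fn x := f (- Num.max x 0) - f 0.
have cfp : continuous fp.
  move=> x; apply: cvgB; last exact: cvg_cst.
  exact: (@continuous_comp _ _ _ _ f x (cmax x) (cf _)).
have cfn : continuous fn.
  move=> x; apply: cvgB; last exact: cvg_cst.
  apply: (@continuous_comp _ _ _ _ f x _ (cf _)).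
  exact: continuousN (cmax x).
have [|F1 F1d] := antiderivative_half cfp.
  by move=> x x0; rewrite /fp (max_idPr _) // subrr.
have [|F2 F2d] := antiderivative_half cfn.
  by move=> x x0; rewrite /fn (max_idPr _) // oppr0 subrr.
exists (fun x => F1 x - (F2 \o -%R) x + f 0 * x) => x.
have dF2 : is_derive x (1:R) (F2 \o -%R) (- fn (- x)).
  have dN := is_deriveNid x (1:R).
  have F2x := F2d (- x).
  apply: DeriveDef.
    apply/derivable1_diffP/differentiable_comp; apply/derivable1_diffP.
      by case: dN.
    by case: F2x.
  rewrite -derive1E derive1_comp ?derive1E ?derive_val ?mulrN1 //.
apply: is_derive_eq; rewrite opprK.
rewrite /fp /fn; have [x0|x0] := leP 0 x.
  rewrite (max_idPr _) ?oppr_le0 // oppr0 subrr addr0.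
  by rewrite /GRing.scale /= mulr1 subrK.
rewrite (max_idPl _) ?oppr_ge0 ?(ltW x0) // opprK subrr add0r.
by rewrite /GRing.scale /= mulr1 subrK.
Qed.

(** Smoothness is proved by exhibiting a class stable under differentiation, without computing
    higher derivatives. *)
Lemma smoothR_closed (S : set (R -> R)) :
  (forall f, S f -> forall t, derivable f t 1) ->
  (forall f, S f -> S (derive1 f)) ->
  forall f, S f -> smoothR f.
Proof.
move=> Sd S' f Sf; split=> k; apply: Sd; elim: k => [|k IH] //.
by rewrite derive1nS; exact: S'.
Qed.

Lemma smoothR_derive1 f : smoothR f -> smoothR (derive1 f).
Proof. by move=> sf; split=> k t; rewrite -derive1Sn; exact: sf. Qed.

Lemma is_derive_smoothR f t : smoothR f -> is_derive t (1:R) f (derive1 f t).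
Proof. by move=> sf; apply: DeriveDef; [exact: (sf 0%N)|rewrite derive1E]. Qed.

Lemma derive1_eq (f g : R -> R) : (forall t, is_derive t (1:R) f (g t)) ->
  derive1 f = g.
Proof. by move=> fg; apply/funext => t; rewrite derive1E derive_val. Qed.

Lemma smoothR_lin (z : R) f g : smoothR f -> smoothR g ->
  smoothR (fun t => z * f t + g t).
Proof.
move=> sf sg; apply: (@smoothR_closed [set h | exists f g : R -> R,
    [/\ smoothR f, smoothR g & h = (fun t => z * f t + g t)]]); last by exists f, g.
- move=> _ [f1 [g1 [sf1 sg1 ->]]] t.
  apply: derivableD; last exact: (sg1 0%N).
  exact: (@derivableZ _ _ _ f1 z _ _ (sf1 0%N t)).
- move=> _ [f1 [g1 [sf1 sg1 ->]]].
  exists (derive1 f1), (derive1 g1).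
  split; [exact: smoothR_derive1|exact: smoothR_derive1|].
  apply: derive1_eq => t.
  have f1E := is_derive_smoothR t sf1; have g1E := is_derive_smoothR t sg1.
  by apply: is_derive_eq.
Qed.

Lemma derive1_lin (z : R) f g : smoothR f -> smoothR g ->
  derive1 (fun t => z * f t + g t) = (fun t => z * derive1 f t + derive1 g t).
Proof.
move=> sf sg; apply: derive1_eq => t.
have fE := is_derive_smoothR t sf; have gE := is_derive_smoothR t sg.
by apply: is_derive_eq.
Qed.

Lemma smoothR0 : smoothR (fun=> 0 : R).
Proof.
apply: (@smoothR_closed [set (fun=> 0 : R)]) => // _ -> //.
by apply: derive1_eq => t; exact: is_derive_cst.
Qed.

Lemma smoothRZ (z : R) f : smoothR f -> smoothR (fun t => z * f t).
Proof.
move=> sf; under eq_fun do rewrite -[_ * _]addr0.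
exact: smoothR_lin sf smoothR0.
Qed.

Lemma is_derive_comp_scale (g : R -> R) (k t dg : R) :
  is_derive (k * t) (1:R) g dg ->
  is_derive t (1:R) (fun t => g (k * t)) (dg * k).
Proof.
move=> gE; have kE : is_derive t (1:R) ( *%R k) k.
  by apply: (@is_derive_eq _ _ _ (k \*: id)); rewrite /GRing.scale /= mulr1.
apply: DeriveDef.
  apply/derivable1_diffP/(@differentiable_comp _ _ _ _ ( *%R k) g);
    apply/derivable1_diffP; [by case: kE|by case: gE].
by rewrite -derive1E (@derive1_comp _ ( *%R k) g) ?derive1E ?derive_val.
Qed.

Definition exp_rate (l : R) : R -> R := fun t => expR (l * t).

Lemma is_derive_exp_rate (l t : R) : is_derive t (1:R) (exp_rate l) (l * exp_rate l t).
Proof. by rewrite mulrC; apply: is_derive_comp_scale. Qed.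

Lemma smoothR_exp_rate l : smoothR (exp_rate l).
Proof.
have E := is_derive_exp_rate l.
apply: (@smoothR_closed [set h | exists c : R, h = (fun t => c * exp_rate l t)]).
- by move=> _ [c ->] t; apply: ex_derive.
- move=> _ [c ->]; exists (c * l); apply: derive1_eq => t.
  by apply: is_derive_eq; rewrite /GRing.scale /= mulrA.
- by exists 1; apply/funext => t; rewrite mul1r.
Qed.

(* Real and imaginary parts of [z' = (al + i be) z + f]. *)
Lemma complex_ode (al be : R) (f : R -> R) : smoothR f ->
  exists a b : R -> R, [/\ smoothR a, smoothR b,
    derive1 a = (fun t => al * a t - be * b t + f t) &
    derive1 b = (fun t => al * b t + be * a t)].
Proof.
move=> sf.
have cf : continuous f.
  move=> t; apply/differentiable_continuous/derivable1_diffP.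
  exact: (sf 0%N).
have ce : continuous (fun t : R => expR (- al * t)).
  move=> t; apply: (@continuous_comp _ _ _ ( *%R (- al)) expR).
    exact: mulrl_continuous.
  exact: continuous_expR.
have ccos : continuous (fun t : R => cos (be * t)).
  move=> t; apply: (@continuous_comp _ _ _ ( *%R be) cos).
    exact: mulrl_continuous.
  exact: continuous_cos.
have csin : continuous (fun t : R => sin (be * t)).
  move=> t; apply: (@continuous_comp _ _ _ ( *%R be) sin).
    exact: mulrl_continuous.
  exact: continuous_sin.
(* Variation of constants: [c - i d] is an antiderivative of [exp (- (al + i be) t) f t], and
   [a + i b] below is its product with [exp ((al + i be) t)]. *)
have [|c cE] := @antiderivative (fun t => expR (- al * t) * cos (be * t) * f t).
  by move=> t; apply: cvgM; [apply: cvgM; [exact: ce|exact: ccos]|exact: cf].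
have [|d dE] := @antiderivative (fun t => expR (- al * t) * sin (be * t) * f t).
  by move=> t; apply: cvgM; [apply: cvgM; [exact: ce|exact: csin]|exact: cf].
pose e := exp_rate al.
have eE (t : R) : is_derive t (1:R) e (al * e t) by exact: is_derive_exp_rate.
have cosE (t : R) : is_derive t (1:R) (fun t => cos (be * t)) (- be * sin (be * t)).
  by rewrite mulNr mulrC -mulNr; apply: is_derive_comp_scale.
have sinE (t : R) : is_derive t (1:R) (fun t => sin (be * t)) (be * cos (be * t)).
  by rewrite mulrC; apply: is_derive_comp_scale.
pose a t := e t * (cos (be * t) * c t + sin (be * t) * d t).
pose b t := e t * (sin (be * t) * c t - cos (be * t) * d t).
have eK (t : R) : e t * expR (- al * t) = 1.
  by rewrite /e /exp_rate -expRD mulNr addrN expR0.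
have cs (t : R) : cos (be * t) ^+ 2 + sin (be * t) ^+ 2 = 1 by exact: cos2Dsin2.
have aE (t : R) : is_derive t (1:R) a (al * a t - be * b t + f t).
  apply: is_derive_eq.
  (* The factors [e t * expR (- al * t) = 1] and [cos ^ 2 + sin ^ 2 = 1] are inserted next to [f t],
     making the goal a polynomial identity. *)
  rewrite -[in RHS](mul1r (f t)) -[in RHS](eK t) -[in RHS](mulr1 (e t * _)).
  rewrite -[in RHS](cs t) /a /b /GRing.scale /=.
  move: (e t) (expR _) (cos _) (sin _) => *; ring.
have bE (t : R) : is_derive t (1:R) b (al * b t + be * a t).
  apply: is_derive_eq.
  rewrite /a /b /GRing.scale /=.
  move: (e t) (expR _) (cos _) (sin _) => *; ring.
exists a, b.
(* The derivatives of [a] and [b] stay among the combinations of [a], [b] and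
   smooth functions. *)
pose S := [set h : R -> R | exists (x y : R) (g : R -> R),
  smoothR g /\ h = (fun t => x * a t + y * b t + g t)].
have SE h : S h -> exists2 g, S g & forall t, is_derive t (1:R) h (g t).
  move=> [x [y [g [sg ->]]]].
  exists (fun t => (x * al + y * be) * a t + (y * al - x * be) * b t +
                   (x * f t + derive1 g t)).
    exists (x * al + y * be), (y * al - x * be), (fun t => x * f t + derive1 g t).
    by split; [exact: smoothR_lin sf (smoothR_derive1 sg)|].
  move=> t; have gE := is_derive_smoothR t sg.
  apply: is_derive_eq; rewrite /GRing.scale /=; ring.
have sS h : S h -> smoothR h.
  apply: smoothR_closed => {}h /SE[g Sg gE] => [t|]; first by case: (gE t).
  by rewrite (derive1_eq gE).
split; [| |exact: derive1_eq aE|exact: derive1_eq bE]; apply: sS.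
- by exists 1, 0, (fun=> 0); split; [exact: smoothR0|];
  apply/funext => t; rewrite mul1r mul0r !addr0.
- by exists 0, 1, (fun=> 0); split; [exact: smoothR0|];
  apply/funext => t; rewrite mul1r mul0r add0r addr0.
Qed.

End Analysis.

(** * Scalar differential operators and their surjectivity *)

Section ScalarOperators.
Variable R : realType.

Definition diffop (q : {poly R}) (f : R -> R) : R -> R :=
  fun t => \sum_(k < size q) q`_k * derive1n k f t.

(** Coefficients beyond the size are zero; a common bound lets operators of different orders be
    compared termwise. *)
Lemma diffopE N (q : {poly R}) f t : (size q <= N)%N ->
  diffop q f t = \sum_(k < N) q`_k * derive1n k f t.
Proof.
move=> qN; rewrite /diffop (big_ord_widen N (fun k => q`_k * derive1n k f t) qN).
rewrite big_mkcond /=; apply: eq_bigr => k _.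
by case: ltnP => // qk; rewrite nth_default // mul0r.
Qed.

Lemma diffopD p q f t : diffop (p + q) f t = diffop p f t + diffop q f t.
Proof.
pose N := maxn (size p) (size q).
rewrite (@diffopE N (p + q)) ?size_polyD // (@diffopE N p) ?leq_maxl //.
rewrite (@diffopE N q) ?leq_maxr // -big_split /=.
by apply: eq_bigr => k _; rewrite coefD mulrDl.
Qed.

Lemma diffop0 f t : diffop 0 f t = 0.
Proof. by rewrite /diffop size_poly0 big_ord0. Qed.

Lemma diffop_sum (I : Type) (r : seq I) (P : I -> {poly R}) f t :
  diffop (\sum_(i <- r) P i) f t = \sum_(i <- r) diffop (P i) f t.
Proof.
elim: r => [|i r IH]; first by rewrite !big_nil diffop0.
by rewrite !big_cons diffopD IH.
Qed.

Lemma diffop_cM c q f t : diffop (c%:P * q) f t = c * diffop q f t.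
Proof.
rewrite mul_polyC (@diffopE (size q)) ?size_scale_leq // /diffop mulr_sumr.
by apply: eq_bigr => k _; rewrite coefZ mulrA.
Qed.

Lemma diffopC c f t : diffop c%:P f t = c * f t.
Proof. by rewrite (@diffopE 1) ?size_polyC_leq1 // big_ord1 coefC. Qed.

Lemma diffop_MX q f t : diffop (q * 'X) f t = diffop q (derive1 f) t.
Proof.
rewrite (@diffopE (size q).+1); last first.
  by rewrite (leq_trans (size_polyMleq _ _)) // size_polyX addn2.
rewrite big_ord_recl coefMX /= mul0r add0r; apply: eq_bigr => k _.
by rewrite coefMX /= -derive1Sn.
Qed.

(** The Horner step behind the inductions on polynomials below. *)
Lemma diffop_cons q c f t :
  diffop (q * 'X + c%:P) f t = c * f t + diffop q (derive1 f) t.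
Proof. by rewrite diffopD diffop_MX diffopC addrC. Qed.

Lemma smoothR_diffop q f : smoothR f -> smoothR (diffop q f).
Proof.
elim/poly_ind: q f => [|q c IH] f sf.
  by rewrite (_ : diffop 0 f = fun=> 0) ?(funext (diffop0 f)) //; exact: smoothR0.
rewrite (_ : diffop _ _ = fun t => c * f t + diffop q (derive1 f) t).
  by apply: smoothR_lin => //; apply: IH; exact: smoothR_derive1.
by apply/funext => t; rewrite diffop_cons.
Qed.

Lemma diffop_lin q (z : R) f g t : smoothR f -> smoothR g ->
  diffop q (fun t => z * f t + g t) t = z * diffop q f t + diffop q g t.
Proof.
elim/poly_ind: q f g => [|q c IH] f g sf sg; first by rewrite !diffop0 mulr0 addr0.
rewrite !diffop_cons derive1_lin // IH; [ring| |]; exact: smoothR_derive1.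
Qed.

Lemma derive1_diffop q f : smoothR f -> derive1 (diffop q f) = diffop q (derive1 f).
Proof.
elim/poly_ind: q f => [|q c IH] f sf.
  rewrite !(funext (diffop0 _)); apply: derive1_eq => t; exact: is_derive_cst.
rewrite !(funext (diffop_cons _ _ _)).
have sf' := smoothR_derive1 sf.
by rewrite derive1_lin ?IH //; exact: smoothR_diffop.
Qed.

Lemma diffopM p q f t : smoothR f -> diffop (p * q) f t = diffop p (diffop q f) t.
Proof.
move=> sf; elim/poly_ind: p q t => [|p c IH] q t; first by rewrite mul0r !diffop0.
rewrite mulrDl diffopD diffop_cM diffop_cons -mulrA -commr_polyX IH derive1_diffop //.
by rewrite addrC (funext (diffop_MX _ _)).
Qed.

Lemma diffop_fun0 q t : diffop q (fun=> 0) t = 0.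
Proof.
have s0 := @smoothR0 R.
rewrite -[RHS](diffop0 (fun=> 0) t) -[in RHS](mulr0 q) (diffopM _ _ _ s0).
by rewrite (funext (diffop0 _)).
Qed.

Lemma diffopZ q (z : R) f t : smoothR f ->
  diffop q (fun t => z * f t) t = z * diffop q f t.
Proof.
move=> sf; rewrite -[RHS]addr0 -(diffop_fun0 q t) -(diffop_lin _ _ _ sf (@smoothR0 R)).
by congr diffop; apply/funext => s; rewrite addr0.
Qed.

(** Induction on the degree: a real linear or irreducible quadratic factor [d] is split off,
    [q = r d], and the equations for [r] and then [d] are solved in turn, the latter by
    [complex_ode]. *)
Lemma diffop_surjective q f : q != 0 -> smoothR f ->
  exists2 z, smoothR z & diffop q z = f.
Proof.
have [n] := ubnP (size q); elim: n q f => // n IH q f qn q0 sf.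
have [q1|q1] := leqP (size q) 1.
  move: q0; rewrite (size1_polyC q1) polyC_eq0 => c0.
  exists (fun t => (q`_0)^-1 * f t); first exact: smoothRZ.
  by apply/funext => t; rewrite diffopC mulVKf.
have [a [b abq]] := real_poly_factor q1.
pose d := if b == 0 then 'X - a%:P else ('X - a%:P) ^+ 2 + (b ^+ 2)%:P.
have dq : d %| q by rewrite /d; case: eqP abq.
have dsurj g : smoothR g -> exists2 z, smoothR z & diffop d z = g.
  move=> sg; have [u [v [su sv uE vE]]] := complex_ode a b sg.
  have LE h t : smoothR h -> diffop ('X - a%:P) h t = derive1 h t - a * h t.
    move=> sh; rewrite (_ : 'X - a%:P = 1 * 'X + (- a)%:P); last by rewrite mul1r polyCN.
    by rewrite diffop_cons (_ : 1 = 1%:P) // diffopC; ring.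
  (* With [L = d/dt - a], [L u = g - b v] and [L v = b u], so that
     [(L^2 + b^2) v = b g]. *)
  rewrite /d; have [b0|b0] := eqVneq b 0.
    exists u => //; apply/funext => t; rewrite LE // uE b0; ring.
  (* The added zero function gives [z] the shape expected by [smoothR_lin] and [derive1_lin]. *)
  pose z t := b^-1 * v t + (fun=> 0 : R) t.
  have sz : smoothR z by apply: smoothR_lin => //; exact: smoothR0.
  have Lz : diffop ('X - a%:P) z = u.
    apply/funext => t; rewrite LE // derive1_lin //; last exact: smoothR0.
    rewrite (_ : derive1 (fun=> 0) = fun=> 0); last first.
      by apply: derive1_eq => s; exact: is_derive_cst.
    by rewrite vE /z !addr0 mulrDr !mulrA mulVf //; ring.
  exists z => //; apply/funext => t.
  rewrite diffopD expr2 diffopM // Lz diffopC LE // uE /z addr0.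
  by rewrite expr2 mulrA mulfK //; ring.
have d1 : (1 < size d)%N.
  rewrite /d; case: ifP => _; first by rewrite size_XsubC.
  by rewrite size_polyDl ?size_exp_XsubC // (leq_ltn_trans (size_polyC_leq1 _)).
have /dvdpP[r qE] := dq.
have r0 : r != 0 by apply: contraNneq q0 => r0; rewrite qE r0 mul0r.
have d0 : d != 0 by rewrite -size_poly_gt0 (leq_trans _ d1).
have rn : (size r < n)%N.
  rewrite -ltnS (leq_trans _ qn) // qE size_mul // ltnS -subn1.
  by rewrite ltn_subRL addnC ltn_add2l.
have [z0 sz0 z0E] := IH r f rn r0 sf.
have [z sz zE] := dsurj z0 sz0.
by exists z => //; apply/funext => t; rewrite qE diffopM // zE z0E.
Qed.

End ScalarOperators.

(** * Matrix differential operators, reduced to coordinates *)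

Section Trajectories.
Variable R : realType.

Definition coord n (w : traj R n) (j : 'I_n) : R -> R := fun t => w t j 0.

Lemma trajP n (w v : traj R n) : (forall j, coord w j = coord v j) -> w = v.
Proof.
move=> wv; apply/funext => t; apply/matrixP => i j; rewrite ord1.
exact: (congr1 (@^~ t) (wv i)).
Qed.

Lemma derive1_coord n (w : traj R n) t : derivable w t 1 ->
  derive1 w t = \col_j derive1 (coord w j) t.
Proof.
move=> dw; rewrite derive1E derive_mx //.
by apply/matrixP => i j; rewrite !mxE ord1 derive1E.
Qed.

Lemma derive1n_coord n (w : traj R n) k :
  (forall j, smoothR (coord w j)) ->
  derive1n k w = (fun t => \col_j derive1n k (coord w j) t).
Proof.
move=> sw; elim: k => [|k IH].
  by apply: trajP => j; apply/funext => t; rewrite /coord mxE.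
rewrite derive1nS IH; apply/funext => t; rewrite derive1_coord; last first.
  apply/derivable_mxP => i j; under eq_fun do rewrite mxE.
  exact: sw.
apply/matrixP => i j; rewrite !mxE; congr (derive1 _ t).
by apply/funext => s; rewrite /coord mxE.
Qed.

Lemma smoothP n (w : traj R n) : smooth w <-> (forall j, smoothR (coord w j)).
Proof.
split=> [sw j|sw k t]; last first.
  rewrite derive1n_coord //; apply/derivable_mxP => i j.
  by under eq_fun do rewrite mxE; exact: sw.
split=> k t; have kE : derive1n k (coord w j) = coord (derive1n k w) j.
  elim: k => [//|k IH]; rewrite !derive1nS IH; apply/funext => s.
  by rewrite /coord derive1_coord // mxE.
rewrite kE; exact: (derivable_mxP _ _ _).1 (sw k t) j 0.
Qed.

Lemma smoothR_coord n (w : traj R n) j : smooth w -> smoothR (coord w j).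
Proof. by move=> /smoothP. Qed.

(** The sums over derivative orders and over columns are exchanged; [pmx_deg P] bounds the size of
    every entry, so each inner sum is a full scalar operator. *)
Lemma coord_polyop r n (P : 'M[{poly R}]_(r, n)) w i t : smooth w ->
  coord (polyop P w) i t = \sum_j diffop (P i j) (coord w j) t.
Proof.
move=> /smoothP sw; rewrite /coord /polyop summxE.
rewrite (eq_bigr (fun k : 'I__ =>
    \sum_j (P i j)`_k * derive1n k (coord w j) t)); last first.
  move=> k _; rewrite mxE; apply: eq_bigr => j _.
  by rewrite derive1n_coord // !mxE.
rewrite exchange_big /=; apply: eq_bigr => j _.
rewrite (@diffopE _ (pmx_deg P)) // /pmx_deg.
apply: leq_trans (leq_bigmax (F := fun i => \max_j size (P i j)) i).
exact: (leq_bigmax (F := fun j => size (P i j))).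
Qed.

Lemma smoothR_sum (I : Type) (r : seq I) (f : I -> R -> R) :
  (forall j, smoothR (f j)) -> smoothR (fun t => \sum_(j <- r) f j t).
Proof.
move=> sf; elim: r => [|i r IH].
  by under eq_fun do rewrite big_nil; exact: smoothR0.
under eq_fun do rewrite big_cons -[f i _]mul1r.
exact: smoothR_lin.
Qed.

Lemma smooth_polyop r n (P : 'M[{poly R}]_(r, n)) w :
  smooth w -> smooth (polyop P w).
Proof.
move=> sw; apply/smoothP => i; rewrite (funext (fun t => coord_polyop P i t sw)).
by apply: smoothR_sum => j; apply: smoothR_diffop; exact: smoothR_coord.
Qed.

Lemma diffop_sumr (I : Type) (r : seq I) q (f : I -> R -> R) t :
  (forall j, smoothR (f j)) ->
  diffop q (fun t => \sum_(j <- r) f j t) t = \sum_(j <- r) diffop q (f j) t.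
Proof.
move=> sf; elim: r => [|i r IH].
  under eq_fun do rewrite big_nil.
  by rewrite big_nil diffop_fun0.
under eq_fun do rewrite big_cons -[f i _]mul1r.
by rewrite diffop_lin ?IH ?mul1r ?big_cons //; exact: smoothR_sum.
Qed.

Lemma polyopM r n l (P : 'M[{poly R}]_(r, n)) (Q : 'M[{poly R}]_(n, l)) w :
  smooth w -> polyop (P *m Q) w = polyop P (polyop Q w).
Proof.
move=> sw; apply: trajP => i; apply/funext => t.
have sQ : smooth (polyop Q w) by exact: smooth_polyop.
rewrite (coord_polyop _ _ _ sw) (coord_polyop _ _ _ sQ).
under eq_bigr do rewrite mxE diffop_sum.
rewrite exchange_big /=; apply: eq_bigr => k _.
rewrite (funext (fun t => coord_polyop Q k t sw)) diffop_sumr; last first.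
  by move=> j; apply: smoothR_diffop; exact: smoothR_coord.
by apply: eq_bigr => j _; rewrite diffopM //; exact: smoothR_coord.
Qed.

Lemma polyopD r n (P Q : 'M[{poly R}]_(r, n)) w :
  smooth w -> polyop (P + Q) w = (fun t => polyop P w t + polyop Q w t).
Proof.
move=> sw; apply: trajP => i; apply/funext => t.
transitivity (coord (polyop P w) i t + coord (polyop Q w) i t); last first.
  by rewrite /coord mxE.
rewrite !coord_polyop // -big_split /=.
by apply: eq_bigr => j _; rewrite mxE diffopD.
Qed.

Lemma smooth_lin n (z : R) (w v : traj R n) : smooth w -> smooth v ->
  smooth (fun t => z *: w t + v t).
Proof.
move=> /smoothP sw /smoothP sv; apply/smoothP => j.
by rewrite /coord; under eq_fun do rewrite !mxE; exact: smoothR_lin (sw j) (sv j).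
Qed.

Lemma polyop_lin r n (P : 'M[{poly R}]_(r, n)) (z : R) (w v : traj R n) :
  smooth w -> smooth v ->
  polyop P (fun t => z *: w t + v t) = (fun t => z *: polyop P w t + polyop P v t).
Proof.
move=> sw sv; apply: trajP => i; apply/funext => t.
transitivity (z * coord (polyop P w) i t + coord (polyop P v) i t); last first.
  by rewrite /coord !mxE.
have swv : smooth (fun t => z *: w t + v t) by exact: smooth_lin.
rewrite (coord_polyop _ _ _ swv) (coord_polyop _ _ _ sw) (coord_polyop _ _ _ sv).
rewrite mulr_sumr -big_split /=; apply: eq_bigr => j _.
rewrite -diffop_lin; [|exact: smoothR_coord|exact: smoothR_coord].
by congr diffop; apply/funext => s; rewrite /coord !mxE.
Qed.

Lemma coord_polyop_scalar n (q : {poly R}) (w : traj R n) j t : smooth w ->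
  coord (polyop q%:M w) j t = diffop q (coord w j) t.
Proof.
move=> sw; rewrite coord_polyop // (bigD1 j) //= big1 => [|i ij].
  by rewrite mxE eqxx mulr1n addr0.
by rewrite mxE eq_sym (negPf ij) mulr0n diffop0.
Qed.

Lemma smooth0 n : smooth (fun=> 0 : 'cV[R]_n).
Proof.
apply/smoothP => j; rewrite /coord; under eq_fun do rewrite mxE.
exact: smoothR0.
Qed.

Lemma polyop0 r n (w : traj R n) : smooth w ->
  polyop (0 : 'M[{poly R}]_(r, n)) w = fun=> 0.
Proof.
move=> sw; apply: trajP => i; apply/funext => t; rewrite coord_polyop //.
by rewrite big1 ?[RHS]mxE // => j _; rewrite mxE diffop0.
Qed.

Lemma polyop_zero r n (P : 'M[{poly R}]_(r, n)) : polyop P (fun=> 0) = fun=> 0.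
Proof.
have s0 := @smooth0 n.
(* The zero trajectory is its own image under the zero matrix, which turns the claim into
   [P *m 0 = 0]. *)
by rewrite -[fun=> 0 in LHS](@polyop0 n n _ s0) -polyopM // mulmx0 polyop0.
Qed.

End Trajectories.

(** * Inclusion of kernels, and refinement of contracts *)

Section Contracts.
Variable R : realType.

Lemma diffop_exp_rate q l t : diffop q (exp_rate (R := R) l) t = q.[l] * exp_rate l t.
Proof.
have se := smoothR_exp_rate l.
elim/poly_ind: q t => [|q c IH] t; first by rewrite diffop0 horner0 mul0r.
rewrite diffop_cons (derive1_eq (is_derive_exp_rate l)) (diffopZ _ _ _ se) IH.
by rewrite hornerMXaddC mulrDl mulrA (mulrC l) addrC.
Qed.

Lemma kerbehM r n l (P : 'M[{poly R}]_(r, n)) (Q : 'M[{poly R}]_(l, r)) :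
  kerbeh P `<=` kerbeh (Q *m P).
Proof. by move=> w [sw Pw]; split=> //; rewrite polyopM // Pw polyop_zero. Qed.

Lemma subset_kerbeh k s p (A : 'M[{poly R}]_(k, p)) (B : 'M[{poly R}]_(s, p)) :
  (forall P : 'M[{poly R}]_p, \det P != 0 ->
     kerbeh P `<=` kerbeh A -> kerbeh P `<=` kerbeh B) ->
  kerbeh A `<=` kerbeh B.
Proof.
move=> AB; have [X [Y [D [AE DD DG dP1]]]] := row_module_square A.
set G := X *m A in AE DG dP1; set C := 1%:M - D in dP1.
have DC : D *m C = 0 by rewrite mulmxBr mulmx1 DD subrr.
have CD : C *m D = 0 by rewrite mulmxBl mul1mx DD subrr.
have CC : C *m C = C by rewrite {1}/C mulmxBl mul1mx DC subr0.
have DC1 : D + C = 1%:M by rewrite addrC subrK.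
clearbody C.
pose P1 := G + C; rewrite -/P1 in dP1.
have DP1 : D *m P1 = G by rewrite mulmxDr DC addr0.
have P1E : P1 = G + C by [].
clearbody P1.
(* [M e] multiplies the rows complementary to [D] by [e]. The choice [e = 'X - l] admits
   exponentials of rate [l], and [e = 1] gives back [P1]. *)
pose M e := D + e *: C; pose P e := M e *m P1.
have dP e : e != 0 -> \det (P e) != 0.
  move=> e0; rewrite det_mulmx mulf_neq0 //; apply/eqP => d0.
  (* An inverse of [M e] up to the factor [e]: if [M e] had determinant zero, a power of [e] would
     vanish. *)
  have : M e *m (e *: D + C) = e%:M.
    rewrite mulmxDl !mulmxDr -!scalemxAl -!scalemxAr DD DC CD CC !scaler0 addr0.
    by rewrite add0r -scalerDr DC1 scalemx1.
  move=> /(congr1 determinant); rewrite det_mulmx d0 mul0r det_scalar => /esym/eqP.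
  by rewrite expf_eq0 (negPf e0) andbF.
have kP e : kerbeh (P e) `<=` kerbeh A.
  (* Since [D M e = D], the product [D P e] is [G] whatever [e] is. *)
  have {1}-> : A = Y *m D *m P e; last exact: kerbehM.
  rewrite {1}AE -!mulmxA (mulmxA D) mulmxDr DD -scalemxAr DC scaler0 addr0.
  by rewrite DP1.
pose N := \adj P1 *m C.
have PN e : P e *m N = (e * \det P1) *: C.
  rewrite /P /N -mulmxA (mulmxA P1) mul_mx_adj mul_scalar_mx -scalemxAr.
  by rewrite mulmxDl DC add0r -scalemxAl CC scalerA mulrC.
have BN : B *m N = 0.
  apply/matrixP => i j; rewrite [RHS]mxE; apply/eqP; set q := (_ *m _) i j.
  apply/negPn/negP => q0.
  have q_eq0 (l : R) : q.[l] = 0.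
    pose z : traj R p := fun t => \col_i ((i == j)%:R * exp_rate l t).
    have cz a : coord z a = fun t => (a == j)%:R * exp_rate l t.
      by apply/funext => t; rewrite /coord mxE.
    have sz : smooth z.
      by apply/smoothP => a; rewrite cz; apply/smoothRZ/smoothR_exp_rate.
    have e0 : 'X - l%:P != 0 by rewrite polyXsubC_eq0.
    have [_] : kerbeh B (polyop N z).
      apply: (AB _ (dP _ e0) (kP _)); split; first exact: smooth_polyop.
      (* [P e N z] is [det P1 C] applied to [('X - l) z], and ['X - l] annihilates the
         exponential. *)
      rewrite -polyopM // PN -scalerA -mul_mx_scalar polyopM //.
      rewrite [X in polyop _ X](_ : _ = fun=> 0) ?polyop_zero //.
      apply: trajP => a; apply/funext => t.
      rewrite (coord_polyop_scalar _ _ _ sz) cz (diffopZ _ _ _ (smoothR_exp_rate _)).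
      by rewrite diffop_exp_rate hornerXsubC subrr mul0r mulr0 /coord mxE.
    (* At time [0] the exponential is [1], so coordinate [i] of [B N z] is [q.[l]]. *)
    rewrite -polyopM // => /(congr1 (fun f => coord f i 0)).
    rewrite (coord_polyop _ _ _ sz) (bigD1 j) //= big1 => [|a aj].
      rewrite cz (diffopZ _ _ _ (smoothR_exp_rate _)) eqxx mul1r diffop_exp_rate addr0.
      by rewrite /exp_rate mulr0 expR0 mulr1 => ->; rewrite /coord mxE.
    by rewrite cz (diffopZ _ _ _ (smoothR_exp_rate _)) (negPf aj) mul0r.
  (* The integers below [size q] are already too many distinct roots. *)
  have /(max_poly_roots q0) : all (root q) [seq i%:R | i <- iota 0 (size q)].
    by apply/allP => l _; rewrite /root q_eq0.
  rewrite map_inj_uniq ?iota_uniq; last exact: mulrIn (oner_neq0 R).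
  by rewrite size_map size_iota ltnn => /(_ isT).
move=> y [sy Ay].
have Gy : polyop G y = fun=> 0 by rewrite polyopM // Ay polyop_zero.
have [z sz zE] : exists2 z, smooth z & polyop (\det P1)%:M z = y.
  have /choice[z zP] j : exists z, smoothR z /\ diffop (\det P1) z = coord y j.
    by have [z sz zE] := diffop_surjective dP1 (smoothR_coord j sy); exists z.
  have cz j : coord (fun t => \col_i z i t) j = z j.
    by apply/funext => t; rewrite /coord mxE.
  have sz : smooth (fun t => \col_i z i t).
    by apply/smoothP => j; rewrite cz; exact: (zP j).1.
  exists (fun t => \col_i z i t) => //; apply: trajP => j; apply/funext => t.
  by rewrite (coord_polyop_scalar _ _ _ sz) cz (zP j).2.
pose y0 := polyop N z; have sy0 : smooth y0 by exact: smooth_polyop.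
pose y1 : traj R p := fun t => (-1) *: y0 t + y t.
have sy1 : smooth y1 by exact: smooth_lin.
have [_ By1] : kerbeh B y1.
  apply: (AB _ (dP 1 (oner_neq0 _)) (kP _)); split=> //.
  (* With [e = 1], [P1 N z = C (det P1 z) = C y], while [P1 y = G y + C y = C y]. *)
  rewrite polyop_lin // /y0 -polyopM // PN mul1r -mul_mx_scalar polyopM // zE.
  rewrite /P /M scale1r DC1 mul1mx P1E polyopD // Gy.
  by apply/funext => t; rewrite add0r scaleN1r addNr.
split=> //; move: By1; rewrite polyop_lin // /y0 -polyopM // BN polyop0 //.
by move=> By1; rewrite -By1; apply/funext => t; rewrite scaler0 add0r.
Qed.

Lemma kerbeh_col_mx r s n (P : 'M[{poly R}]_(r, n)) (Q : 'M[{poly R}]_(s, n)) :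
  kerbeh (col_mx P Q) = kerbeh P `&` kerbeh Q.
Proof.
apply/seteqP; split => w.
  move=> PQw; split.
    have -> : P = row_mx 1%:M 0 *m col_mx P Q.
      by rewrite mul_row_col mul1mx mul0mx addr0.
    exact: kerbehM.
  have -> : Q = row_mx 0 1%:M *m col_mx P Q.
    by rewrite mul_row_col mul1mx mul0mx add0r.
  exact: kerbehM.
move=> [[sw Pw] [_ Qw]]; split=> //.
have -> : col_mx P Q = col_mx 1%:M 0 *m P + col_mx 0 1%:M *m Q.
  by rewrite !mul_col_mx !mul1mx !mul0mx add_col_mx addr0 add0r.
rewrite polyopD // !polyopM // Pw Qw !polyop_zero.
by apply/funext => t; rewrite addr0.
Qed.

Lemma refines_subset m p r s (A1 : 'M[{poly R}]_(r, m))
    (G1 : 'M[{poly R}]_(s, p)) (C : bcontract R m p) :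
  refines (contract_sem C) (kerbeh A1, kerbeh G1) ->
  kerbeh A1 `<=` latbeh (c_AU C) (c_AL C) /\ kerbeh (c_G C) `<=` kerbeh G1.
Proof.
(* [A1] is itself an environment compatible with its own assumptions. *)
move=> [CA CG]; split; first exact: CA.
apply: subset_kerbeh => P dP PG y Py; have [sy Py0] := Py.
have impl : implements P (0 : 'M[{poly R}]_(p, m)) (kerbeh A1) (kerbeh G1).
  apply: CG.
    by split=> // i j; rewrite mulmx0 mxE size_poly0.
  move=> k E _ y' [u [[su _] [_ [sy' Py']]]]; apply: PG; split=> //.
  by rewrite Py' /= polyop0.
(* The environment [A1] admits the zero input, under which every trajectory of [ker P] is an
   output. *)
apply: (impl _ A1) => //; exists (fun=> 0); split; split; try exact: smooth0.
  exact: polyop_zero.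
by split => //=; rewrite Py0 polyop_zero.
Qed.

Lemma kerbeh_sub_joinl m r1 r2 (A1 : 'M[{poly R}]_(r1, m))
    (A2 : 'M[{poly R}]_(r2, m)) :
  kerbeh A1 `<=` join_beh A1 A2.
Proof.
move=> u [su Au]; exists u, (fun=> 0).
split; [exact: su|split; [exact: smooth0|split]].
  by apply/funext => t; rewrite addr0.
by split; [exact: Au|exact: polyop_zero].
Qed.

Lemma join_behC m r1 r2 (A1 : 'M[{poly R}]_(r1, m))
    (A2 : 'M[{poly R}]_(r2, m)) :
  join_beh A1 A2 `<=` join_beh A2 A1.
Proof.
move=> _ [l1 [l2 [s1 [s2 [-> [A1l A2l]]]]]]; exists l2, l1.
split; [exact: s2|split; [exact: s1|split; [|by split]]].
by apply/funext => t; rewrite addrC.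
Qed.

Lemma latbehD m r l (AU : 'M[{poly R}]_(r, m)) (AL : 'M[{poly R}]_(r, l)) u v :
  latbeh AU AL u -> latbeh AU AL v -> latbeh AU AL (fun t => u t + v t).
Proof.
(* The scalar [1] puts sums in the form handled by [smooth_lin] and [polyop_lin]. *)
have addE n (w w' : traj R n) : (fun t => w t + w' t) = (fun t => 1 *: w t + w' t).
  by apply/funext => t; rewrite scale1r.
move=> [su [x [sx ux]]] [sv [y [sy vy]]]; rewrite addE; split; first exact: smooth_lin.
exists (fun t => 1 *: x t + y t); split; first exact: smooth_lin.
rewrite !polyop_lin //; apply/funext => t; rewrite !scale1r addrACA.
have /(congr1 (@^~ t)) /= -> := ux; have /(congr1 (@^~ t)) /= -> := vy.
by rewrite addr0.
Qed.

Lemma subset_refines m p (A A' : set (traj R m)) (G G' : set (traj R p)) :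
  A' `<=` A -> G `<=` G' -> refines (A, G) (A', G').
Proof.
move=> AA GG; split=> [k E EA|P Q _ impl k E EA] /=; first exact: subset_trans AA.
by apply: subset_trans GG; apply: impl; exact: subset_trans AA.
Qed.

End Contracts.

Theorem theorem5 (R : realType) (m p r1 r2 s1 s2 : nat)
  (A1 : 'M[{poly R}]_(r1, m)) (A2 : 'M[{poly R}]_(r2, m))
  (G1 : 'M[{poly R}]_(s1, p)) (G2 : 'M[{poly R}]_(s2, p)) :
  let C1 := (kerbeh A1, kerbeh G1) in
  let C2 := (kerbeh A2, kerbeh G2) in
  let Cconj := (join_beh A1 A2, kerbeh (col_mx G1 G2)) in
  [/\ refines Cconj C1, refines Cconj C2 &
      forall C : @bcontract R m p,
        refines (contract_sem C) C1 -> refines (contract_sem C) C2 ->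
        refines (contract_sem C) Cconj].
Proof.
move=> C1 C2 Cconj; split.
- apply: subset_refines; first exact: kerbeh_sub_joinl.
  by rewrite kerbeh_col_mx; exact: subIsetl.
- apply: subset_refines; last by rewrite kerbeh_col_mx; exact: subIsetr.
  exact: subset_trans (@kerbeh_sub_joinl _ _ _ _ _ _) (@join_behC _ _ _ _ _ _).
move=> C /refines_subset[A1C CG1] /refines_subset[A2C CG2].
apply: subset_refines; last by rewrite kerbeh_col_mx => y Cy; split; [exact: CG1|exact: CG2].
move=> _ [l1 [l2 [sl1 [sl2 [-> [A1l A2l]]]]]].
by apply: latbehD; [exact: A1C|exact: A2C].
Qed.
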